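(* Let $q$ be a prime power, let $d\ge 1$ be a divisor of $q-1$, and let $h(x)=\sum_{i=1}^{t}c_ix^{e_i}\in\mathbb{F}_q[x]$ be a $t$-sparse polynomial. Suppose that there exist integers $a_i,b_i$ ($i=1,2,\ldots,t$) such that $$e_i=a_i\frac{q-1}{d}+b_i,\qquad\text{where } -\frac{q-1}{d}<b_i<\frac{q-1}{d}.$$ Let $A,B$ be integers such that $\{b_i:1\le i\le t\}$ is contained in the interval $[A,B]$. If $h(x)$ does not vanish (identically) on any coset of $(\mathbb{F}_q^* )^d$ in $\mathbb{F}_q^*$, then $|Z(h)|\le d(B-A)$.
   Context: A $t$-sparse polynomial is a polynomial with $t$ terms in its monomial expansion (so the $e_i$ are distinct nonnegative integers and the $c_i\in\mathbb{F}_q$ are nonzero). $(\mathbb{F}_q^* )^d=\{a^d:a\in\mathbb{F}_q^*\}$ is the subgroup of $d$-th powers. For a polynomial $h\in\mathbb{F}_q[x]$, $Z(h)$ denotes the set of (distinct) roots of $h$ lying in $\mathbb{F}_q^*=\mathbb{F}_q\setminus\{0\}$. *)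

(* Defs.v *)
From HB Require Import structures.
From mathcomp Require Import all_boot all_order all_algebra all_fingroup.
Set Implicit Arguments.
Unset Strict Implicit.
Unset Printing Implicit Defensive.
Import Order.TTheory GRing.Theory Num.Theory.
Local Open Scope ring_scope.

(* The subgroup of d-th powers, inside the multiplicative group {unit F}. *)
Definition dpowers (F : finFieldType) (d : nat) : {set {unit F}} :=
  [set (u ^+ d)%g | u : {unit F}].

Definition nonzero_roots (F : finFieldType) (h : {poly F}) : {set F} :=
  [set x | (x != 0) && root h x].

Definition vanishes_on (F : finFieldType) (h : {poly F})
    (C : {set {unit F}}) : Prop :=
  forall u : {unit F}, u \in C -> h.[val u] = 0.

(* Main.v *)
(* Put n = (q - 1) / d.  On a fiber x^n = w of the n-th power map, x^(e i) equals
   w^(a i) x^(b i), so x^(-A) h(x) agrees there with a polynomial of degree at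
   most B - A.  That polynomial is nonzero, as otherwise h would vanish on the
   whole fiber, which contains a coset of the d-th powers; hence h has at most
   B - A roots in the fiber.  The n-th powers are d-th roots of unity, so there
   are at most d fibers. *)
Require Import Defs.
From HB Require Import structures.
From mathcomp Require Import all_boot all_order all_algebra all_fingroup.
From mathcomp Require Import finfield zify.
Set Implicit Arguments.
Unset Strict Implicit.
Unset Printing Implicit Defensive.
Import Order.TTheory GRing.Theory Num.Theory.
Local Open Scope ring_scope.

Lemma card_roots_lt_size (F : finFieldType) (p : {poly F}) (S : {set F}) :
  p != 0 -> {in S, forall x, root p x} -> (#|S| < size p)%N.
Proof.
move=> p0 rS; rewrite cardE; apply: max_poly_roots => //; last exact: enum_uniq.
by apply/allP => x; rewrite mem_enum; apply: rS.
Qed.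

Lemma card_le_mul_fibers (T U : finType) (f : T -> U) (S : {set T}) (k : nat) :
  {in S, forall y, #|[set x in S | f x == f y]| <= k}%N ->
  (#|S| <= #|f @: S| * k)%N.
Proof.
move=> fk; rewrite -sum1_card (partition_big_imset f) /= -sum_nat_const.
apply: leq_sum => _ /imsetP[y yS ->].
by rewrite sum1dep_card; apply: fk.
Qed.

Lemma expf_card_pred (F : finFieldType) (x : F) :
  x != 0 -> x ^+ (#|F| - 1) = 1.
Proof.
move=> x0; apply: (mulfI x0); rewrite -exprS subn1 prednK ?mulr1 ?expf_card //.
exact/card_gt0P/(ex_intro _ x).
Qed.

(** This is x^(-A) h(x) with x^n frozen to the constant [w]. A negative [a i] only affects a
    coefficient, and the shift by [A] makes the exponents of ['X] natural numbers once [A <= b i].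
    Several [b i] may coincide, so terms can cancel and the sum can be zero. *)
Definition fiber_poly (F : fieldType) (t : nat) (c : 'I_t -> F)
    (a b : 'I_t -> int) (A : int) (w : F) : {poly F} :=
  \sum_(i < t) (c i * w ^ a i) *: 'X^(`|b i - A|%N).

Lemma size_fiber_poly (F : fieldType) (t : nat) (c : 'I_t -> F)
    (a b : 'I_t -> int) (A B : int) (w : F) :
  (forall i, A <= b i /\ b i <= B) ->
  (size (fiber_poly c a b A w) <= `|B - A|.+1)%N.
Proof.
move=> b_AB; apply: (leq_trans (size_sum _ _ _)); apply/bigmax_leqP => i _.
apply: (leq_trans (size_scale_leq _ _)); rewrite size_polyXn ltnS.
have [? ?] := b_AB i; lia.
Qed.

(** Termwise, n a_i + (b_i - A) = e_i - A; adding integer exponents of either sign requires x to be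
    nonzero. *)
Lemma horner_fiber_poly (F : fieldType) (t n : nat) (c : 'I_t -> F)
    (e : 'I_t -> nat) (a b : 'I_t -> int) (A : int) (x : F) :
  (forall i, (e i)%:Z = a i * n%:Z + b i) -> (forall i, A <= b i) -> x != 0 ->
  (fiber_poly c a b A (x ^+ n)).[x] =
  x ^ (- A) * (\sum_(i < t) c i *: 'X^(e i)).[x].
Proof.
move=> e_def A_le_b x0; rewrite !horner_sum mulr_sumr; apply: eq_bigr => i _.
rewrite !hornerZ !hornerXn mulrCA -mulrA; congr (_ * _).
have bA : (`|b i - A|%N)%:Z = b i - A by rewrite gez0_abs // subr_ge0.
rewrite (exprnP x n) (exprnP x (e i)) (exprnP x `|b i - A|%N) exprz_exp bA.
by rewrite -!expfzDr // e_def; congr (_ ^ _); lia.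
Qed.

Theorem theorem3p9 (F : finFieldType) (q : nat) (hq : #|F| = q)
    (d : nat) (d_gt0 : (0 < d)%N) (d_dvd : (d %| q - 1)%N)
    (t : nat) (c : 'I_t -> F) (e : 'I_t -> nat)
    (c_neq0 : forall i, c i != 0) (e_inj : injective e)
    (h : {poly F}) (h_def : h = \sum_(i < t) c i *: 'X^(e i))
    (a b : 'I_t -> int)
    (e_def : forall i, (e i)%:Z = a i * ((q - 1) %/ d)%N%:Z + b i)
    (b_bound : forall i,
       - ((q - 1) %/ d)%N%:Z < b i /\ b i < ((q - 1) %/ d)%N%:Z)
    (A B : int) (b_AB : forall i, A <= b i /\ b i <= B)
    (h_coset : forall C : {set {unit F}},
       C \in lcosets (dpowers F d) [set: {unit F}] -> ~ vanishes_on h C) :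
  (#|nonzero_roots h|)%:Z <= d%:Z * (B - A).
Proof.
set n := ((q - 1) %/ d)%N in e_def b_bound.
have nd : (n * d)%N = (#|F| - 1)%N by rewrite hq divnK.
(* An index is needed to get [A <= B] from [b_AB]. With [t = 0], h would be zero and vanish on the
   subgroup of d-th powers itself. *)
have t_gt0 : (0 < t)%N.
  case: (posnP t) => // t0; case: (h_coset (1%g *: dpowers F d)%g).
    by apply/lcosetsP; exists 1%g; rewrite ?inE.
  move=> u _; rewrite h_def big1 ?horner0 // => i.
  by have := ltn_ord i; rewrite [X in (_ < X)%N]t0.
have leAB : A <= B by have [lA lB] := b_AB (Ordinal t_gt0); apply: le_trans lB.
pose f (x : F) := x ^+ n.
have fiber_le : {in nonzero_roots h, forall y,
    #|[set x in nonzero_roots h | f x == f y]| <= `|B - A|}%N.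
  move=> y; rewrite inE => /andP[y0 _].
  pose g := fiber_poly c a b A (f y).
  (* The successor in the size bound is absorbed by the strict inequality between the number of
     roots and the size. *)
  rewrite -ltnS; apply: leq_trans (size_fiber_poly c a (f y) b_AB).
  have gE x : x != 0 -> f x = f y -> g.[x] = x ^ (- A) * h.[x].
    by move=> x0 fx; rewrite /g -fx (horner_fiber_poly c e_def) ?h_def // => i;
      case: (b_AB i).
  apply: card_roots_lt_size.
    (* If g = 0, then h vanishes on the coset of [y]: each of its elements y v^d lies in the fiber
       of [y], since v^(dn) = v^(q-1) = 1. *)
    apply/eqP => g0.
    have yU : y \is a GRing.unit by rewrite unitfE.
    pose u : {unit F} := Sub y yU.
    case: (h_coset (u *: dpowers F d)%g).
      by apply/lcosetsP; exists u; rewrite ?inE.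
    move=> _ /lcosetP[_ /imsetP[v _ ->] ->].
    have v0 : val v != 0 by rewrite -unitfE; exact: valP.
    have xE : val (u * v ^+ d)%g = y * val v ^+ d.
      by rewrite FinRing.val_unitM FinRing.val_unitX.
    have x0 : y * val v ^+ d != 0 by rewrite mulf_neq0 ?expf_neq0.
    rewrite xE; have := gE _ x0; rewrite [g]g0 horner0 => /(_ _)/esym/eqP.
    (* The factor x^(-A) is nonzero and cancels; what remains to check is that the point lies in the
       fiber. *)
    rewrite mulf_eq0 expfz_eq0 (negbTE x0) andbF /= => gx; apply/eqP/gx.
    by rewrite /f exprMn -exprM mulnC nd expf_card_pred // mulr1.
  move=> x; rewrite !inE => /andP[/andP[x0 /eqP hx] /eqP fx].
  by apply/eqP; rewrite -/g gE // hx mulr0.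
have image_le : (#|f @: nonzero_roots h| <= d)%N.
  (* Since (x^n)^d = x^(q-1) = 1, the image consists of roots of X^d - 1. *)
  rewrite cardE; apply: max_unity_roots => //; last exact: enum_uniq.
  apply/allP => w; rewrite mem_enum => /imsetP[x].
  rewrite inE => /andP[x0 _] ->.
  by rewrite unity_rootE /f -exprM nd expf_card_pred.
have := leq_trans (card_le_mul_fibers fiber_le) (leq_mul image_le (leqnn _)).
by rewrite -lez_nat PoszM gez0_abs ?subr_ge0.
Qed.
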